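(* Let $S$ and $T$ be disjoint finite sets and let $m_S:S\to\mathbb{Z}_+$, $m_T:T\to\mathbb{Z}_+$ satisfy $\widetilde m_S(S)=\widetilde m_T(T)=\gamma$. Let $p_T$ be a positively intersecting supermodular set-function on $T$ with $p_T(\emptyset)=0$ and $p_T(Y)\le |S|$ for all $Y\subseteq T$. There is a simple bipartite graph $G=(S,T;E)$ covering $p_T$ (i.e. $|\Gamma_G(Y)|\ge p_T(Y)$ for all $Y\subseteq T$) with $d_G(v)=m_S(v)$ for $v\in S$ and $d_G(v)=m_T(v)$ for $v\in T$ if and only if $$\widetilde m_S(X)+\widetilde m_T(Y)-|X||Y|+\widetilde p_T(\mathcal T)-|\mathcal T||X|\le\gamma$$ holds for every $X\subseteq S$, $Y\subseteq T$ and every subpartition $\mathcal T$ of $T-Y$ (including the empty subpartition $\mathcal T=\emptyset$). When $p_T$ is fully supermodular, it suffices to require this inequality only for subpartitions with $|\mathcal T|\le 1$. When $p_T$ is fully supermodular and monotone non-decreasing, it suffices to require it only for $\mathcal T=\emptyset$ and $\mathcal T=\{T-Y\}$.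
   Context: A bipartite graph $G=(S,T;E)$ is simple if it has no parallel edges; $\Gamma_G(Y)$ is the set of nodes in $S$ adjacent to some node of $Y\subseteq T$; $d_G(v)$ is the degree of $v$. $\widetilde m(X)=\sum_{v\in X}m(v)$. A subpartition of a set is a family of pairwise disjoint nonempty subsets (possibly empty family); $\widetilde p(\mathcal T)=\sum_{W\in\mathcal T}p(W)$, equal to $0$ for the empty family. $p$ is positively intersecting supermodular if $p(X)+p(Y)\le p(X\cap Y)+p(X\cup Y)$ whenever $X\cap Y\ne\emptyset$, $p(X)>0$, $p(Y)>0$; fully supermodular if this inequality holds for all $X,Y\subseteq T$; monotone non-decreasing if $p(X)\le p(Y)$ whenever $\emptyset\subset X\subseteq Y\subseteq T$. *)

(* Defs.v *)
From mathcomp Require Import all_boot all_order all_algebra.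

Set Implicit Arguments.
Unset Strict Implicit.
Unset Printing Implicit Defensive.

Import Order.TTheory GRing.Theory Num.Theory.
Local Open Scope ring_scope.

Definition tilde (V : finType) (m : V -> nat) (X : {set V}) : nat :=
  (\sum_(v in X) m v)%N.

Definition ptilde (T : finType) (p : {set T} -> int) (P : {set {set T}}) : int :=
  \sum_(W in P) p W.

(* The members of P are automatically distinct, P being a set of sets; the
   empty family set0 is a subpartition of every set. *)
Definition subpartition (T : finType) (A : {set T}) (P : {set {set T}}) : Prop :=
  [/\ set0 \notin P, trivIset P & cover P \subset A].

Definition pos_intersecting_supermodular (T : finType) (p : {set T} -> int) : Prop :=
  forall X Y : {set T}, X :&: Y != set0 -> 0 < p X -> 0 < p Y ->
    p X + p Y <= p (X :&: Y) + p (X :|: Y).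

Definition fully_supermodular (T : finType) (p : {set T} -> int) : Prop :=
  forall X Y : {set T}, p X + p Y <= p (X :&: Y) + p (X :|: Y).

(* The empty set is excluded: p may be negative on nonempty sets although
   p set0 = 0. *)
Definition monotone_nondecreasing (T : finType) (p : {set T} -> int) : Prop :=
  forall X Y : {set T}, X != set0 -> X \subset Y -> p X <= p Y.

(* A simple bipartite graph with colour classes S and T is its set of edges:
   (s, t) \in G means that s and t are adjacent. Being a set, G has no parallel
   edges, and distinct types make the two classes disjoint. *)
Definition bigraph (S T : finType) := {set S * T}.

Section Bigraph.
Variables (S T : finType) (G : bigraph S T).

Definition Gamma (Y : {set T}) : {set S} :=
  [set s | [exists t in Y, (s, t) \in G]].

Definition degS (s : S) : nat := #|[set e in G | e.1 == s]|.

Definition degT (t : T) : nat := #|[set e in G | e.2 == t]|.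

Definition covers (p : {set T} -> int) : Prop :=
  forall Y : {set T}, p Y <= #|Gamma Y|%:Z.

Definition fits (mS : S -> nat) (mT : T -> nat) : Prop :=
  (forall s : S, degS s = mS s) /\ (forall t : T, degT t = mT t).

End Bigraph.

Definition degree_ineq (S T : finType) (mS : S -> nat) (mT : T -> nat)
    (gamma : nat) (p : {set T} -> int)
    (X : {set S}) (Y : {set T}) (P : {set {set T}}) : Prop :=
  (tilde mS X)%:Z + (tilde mT Y)%:Z - #|X|%:Z * #|Y|%:Z
    + ptilde p P - #|P|%:Z * #|X|%:Z <= gamma%:Z.

(* Main.v *)
(* Forcing q {t} = m_T(t) on singletons and q = p_T elsewhere keeps positive
   intersecting supermodularity and turns the degree inequality into
     sum_(W in P) (q W - lam) <= the sum of all but the lam largest m_S(s)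
   for all lam >= 0 and all families P of disjoint nonempty sets. A graph is then built
   one node s at a time, in order of decreasing m_S: s receives a set Z of
   neighbours, and q W drops by one whenever W meets Z. The set Z is grown
   greedily; a next element works if it lies, for each pair (lam, P) attaining
   the bound, in a member of P not yet met by Z. Uncrossing such pairs makes
   families at a smaller lam finer than those at a larger lam. Hence all members
   meeting an unmet member W of the coarsest family at the largest lam lie inside W,
   and descending through the finest families for decreasing lam inside W gives a
   nested chain of sets whose last one lies in a suitable member for every pair. *)

Require Import Defs.
From mathcomp Require Import all_boot all_order all_algebra.
From mathcomp Require Import zify.

Set Implicit Arguments.
Unset Strict Implicit.
Unset Printing Implicit Defensive.

Import Order.TTheory GRing.Theory Num.Theory.
Local Open Scope ring_scope.

(** * Sums over finite sets *)

Lemma big_disjoint_setU (R : Type) (idx : R) (op : Monoid.com_law idx)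
    (I : finType) (A B : {set I}) (f : I -> R) :
  [disjoint A & B] ->
  \big[op/idx]_(i in A :|: B) f i =
    op (\big[op/idx]_(i in A) f i) (\big[op/idx]_(i in B) f i).
Proof.
by move=> dAB; rewrite -bigU //; apply: eq_bigl => i; rewrite !inE.
Qed.

Lemma sumz_const (I : finType) (A : {set I}) (c : int) :
  \sum_(i in A) c = #|A|%:Z * c.
Proof. by rewrite sumr_const -mulr_natl natz. Qed.

(** * Families of disjoint nonempty sets and their weight *)

Section Families.
Variable T : finType.
Implicit Types (A B W U : {set T}) (P Q R : {set {set T}}).

Definition disj_family P : bool := trivIset P && (set0 \notin P).

Lemma disj_familyP P :
  reflect ((forall A, A \in P -> A != set0) /\
           (forall A B, A \in P -> B \in P -> A :&: B != set0 -> A = B))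
          (disj_family P).
Proof.
apply: (iffP andP) => [[tP nP]|[nP tP]]; split.
- by move=> A AP; apply: contraNneq nP => <-.
- move=> A B AP BP; rewrite setI_eq0; apply: contraNeq => AB.
  by move/trivIsetP: tP; apply.
- apply/trivIsetP => A B AP BP; apply: contraR; rewrite -setI_eq0 => AB.
  by apply/eqP/tP.
- by apply/negP => /nP; rewrite eqxx.
Qed.

Lemma disj_familyS P Q : Q \subset P -> disj_family P -> disj_family Q.
Proof.
move=> /subsetP QP /disj_familyP [nP tP]; apply/disj_familyP; split.
  by move=> A /QP /nP.
by move=> A B /QP AP /QP BP; apply: tP.
Qed.

Lemma disj_family1 A : A != set0 -> disj_family [set A].
Proof.
by move=> nA; apply/disj_familyP; split=> [B|B C] /set1P ->// /set1P ->.
Qed.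

Lemma disj_family_replace P Q R :
  disj_family P -> disj_family R ->
  (forall A B, A \in R -> B \in P :\: Q -> A :&: B = set0) ->
  disj_family (P :\: Q :|: R).
Proof.
move=> /(disj_familyS (subsetDl P Q)) /disj_familyP [nP tP].
move=> /disj_familyP [nR tR] dPR.
apply/disj_familyP; split=> [A /setUP [/nP|/nR]//|].
move=> A B /setUP [AP|AR] /setUP [BP|BR]; [exact: tP| | |exact: tR].
  by rewrite setIC dPR ?eqxx.
by rewrite dPR ?eqxx.
Qed.

(* Refining a member strictly lowers the weight, also when nothing is lost:
   splitting W into k parts costs k - 1. *)
Definition weight P : nat := (\sum_(W in P) (2 * #|W| - 1))%N.

Lemma weightE P : disj_family P -> (weight P + #|P| = 2 * #|cover P|)%N.
Proof.
move=> dP; case/andP: (dP) => /eqP <- _; rewrite -sum1_card big_distrr /=.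
rewrite -big_split /=; apply: eq_bigr => W WP.
case/disj_familyP: dP => /(_ W WP); rewrite -card_gt0; lia.
Qed.

Lemma weight1 W : weight [set W] = (2 * #|W| - 1)%N.
Proof. exact: big_set1. Qed.

Lemma weight_replace P Q R :
  Q \subset P -> [disjoint P :\: Q & R] ->
  (weight (P :\: Q :|: R) + weight Q = weight P + weight R)%N.
Proof.
move=> QP dPR; rewrite /weight big_disjoint_setU //.
rewrite [in RHS](big_setID Q) /= (setIidPr QP); lia.
Qed.

(** * Families attaining the bound, and exchanges in them *)

Variables (r : {set T} -> int) (F : nat -> int).

Definition excess (lam : nat) P : int := \sum_(W in P) (r W - lam%:Z).

Lemma excess1 lam W : excess lam [set W] = r W - lam%:Z.
Proof. exact: big_set1. Qed.

Lemma excessE lam P : excess lam P = \sum_(W in P) r W - #|P|%:Z * lam%:Z.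
Proof.
by rewrite /excess sumrB sumz_const.
Qed.

Lemma excess_replace lam P Q R :
  Q \subset P -> [disjoint P :\: Q & R] ->
  excess lam (P :\: Q :|: R) + excess lam Q = excess lam P + excess lam R.
Proof.
move=> QP dPR; rewrite /excess big_disjoint_setU //.
by rewrite [in RHS](big_setID Q) /= (setIidPr QP) addrAC [in RHS]addrC.
Qed.

(** Members of value at most [lam] are excluded: all members then have positive value, so
    supermodularity applies to them, and each contributes at least one to the excess. *)
Definition tight (lam : nat) P : bool :=
  [&& disj_family P, [forall W in P, lam%:Z < r W] & excess lam P == F lam].

Hypothesis r_super : pos_intersecting_supermodular r.
Hypothesis F_bound : forall lam P, disj_family P -> excess lam P <= F lam.

Lemma tight_gt lam P W : tight lam P -> W \in P -> lam%:Z < r W.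
Proof. by move=> /and3P [_ /forall_inP H _]; apply: H. Qed.

Lemma tight_disj lam P : tight lam P -> disj_family P.
Proof. by case/and3P. Qed.

Lemma tight_excess lam P : tight lam P -> excess lam P = F lam.
Proof. by case/and3P => _ _ /eqP. Qed.

(** The discarded members contribute at most zero, so the excess does not fall; by [F_bound] it
    cannot rise either. *)
Lemma tight_filter lam P :
  disj_family P -> excess lam P = F lam ->
  tight lam [set W in P | lam%:Z < r W].
Proof.
set Q := [set W in P | _] => dP eP.
have QP : Q \subset P by apply/subsetP => W; rewrite inE => /andP [].
have dQ := disj_familyS QP dP.
apply/and3P; split=> //; first by apply/forall_inP => W; rewrite inE => /andP [].
rewrite eq_le F_bound //= -eP /excess (big_setID Q) /= (setIidPr QP).
rewrite gerDl; apply: sumr_le0 => W /setDP [WP]; rewrite inE WP /= => H.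
by rewrite subr_le0 leNgt.
Qed.

Lemma weight_filter P (p : pred {set T}) :
  (weight [set W in P | p W] <= weight P)%N.
Proof.
rewrite /weight [leqRHS](big_setID [set W in P | p W]) /=.
rewrite (setIidPr _); first exact: leq_addr.
by apply/subsetP => W; rewrite inE => /andP [].
Qed.

Lemma replace_disjoint P Q R :
  disj_family R -> (forall A B, A \in R -> B \in P :\: Q -> A :&: B = set0) ->
  [disjoint P :\: Q & R].
Proof.
move=> /disj_familyP [nR _] dPR; rewrite -setI_eq0; apply/eqP/setP => W.
rewrite in_set0; apply/negP => /setIP [WP WR].
by have := nR _ WR; rewrite -[W]setIid dPR ?eqxx.
Qed.

(** Exchanging [Q] for [R] leaves a disjoint family, whose excess cannot pass the bound that [P]
    attains. *)
Lemma tight_replace lam P Q R :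
  tight lam P -> Q \subset P -> disj_family R ->
  (forall A B, A \in R -> B \in P :\: Q -> A :&: B = set0) ->
  excess lam R <= excess lam Q.
Proof.
move=> tP QP dR dPR.
have := excess_replace lam QP (replace_disjoint dR dPR).
have := F_bound lam (disj_family_replace (tight_disj tP) dR dPR).
by rewrite (tight_excess tP); clear; lia.
Qed.

(** Otherwise [B] could be added to [P], raising the excess above the bound. *)
Lemma tight_meets lam P B :
  tight lam P -> B != set0 -> lam%:Z < r B ->
  exists2 A, A \in P & A :&: B != set0.
Proof.
move=> tP nB rB; apply/exists_inP; apply: contraLR rB => /exists_inPn H.
have := @tight_replace lam P set0 [set B] tP (sub0set _) (disj_family1 nB).
rewrite excess1 /excess big_set0 subr_le0 -leNgt; apply=> A C /set1P ->.
by rewrite setD0 => /H; rewrite negbK setIC => /eqP.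
Qed.

(** * Uncrossing a member of one tight family with the members of another *)

Definition meeting P A : {set {set T}} := [set B in P | A :&: B != set0].

Definition slices P A : {set {set T}} := [set A :&: B | B in P].

Lemma meeting_sub P A : meeting P A \subset P.
Proof. by apply/subsetP => B; rewrite inE => /andP []. Qed.

Section Slices.
Variables (P : {set {set T}}) (A : {set T}).
Hypotheses (dP : disj_family P) (mP : forall B, B \in P -> A :&: B != set0).

Lemma slices_inj : {in P &, injective (fun B => A :&: B)}.
Proof.
move=> B C BP CP /= E; case/disj_familyP: dP => _; apply=> //.
apply: contraNneq (mP BP) => BC; rewrite -subset0 -BC subsetI subsetIr E.
exact: subsetIr.
Qed.

Lemma slices_disj : disj_family (slices P A).
Proof.
apply/disj_familyP; split=> [_ /imsetP [B BP ->]|]; first exact: mP.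
move=> _ _ /imsetP [B BP ->] /imsetP [C CP ->] BC; congr (_ :&: _).
case/disj_familyP: dP => _; apply=> //; apply: contraNneq BC.
by rewrite setIACA => ->; rewrite setI0.
Qed.

Lemma card_slices : #|slices P A| = #|P|.
Proof. exact: card_in_imset slices_inj. Qed.

Lemma excess_slices lam :
  excess lam (slices P A) = \sum_(B in P) (r (A :&: B) - lam%:Z).
Proof. by rewrite /excess (big_imset _ slices_inj). Qed.

Lemma cover_slices : cover (slices P A) \subset A.
Proof. by apply/bigcupsP => _ /imsetP [B _ ->]; apply: subsetIl. Qed.

End Slices.

(** The slices of [A] are disjoint from the other members of [P], so they may be exchanged for
    [A]. *)
Lemma slices_excess_le lam P A Q :
  tight lam P -> A \in P -> disj_family Q ->
  (forall B, B \in Q -> A :&: B != set0) ->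
  \sum_(B in Q) (r (A :&: B) - lam%:Z) <= r A - lam%:Z.
Proof.
move=> tP AP dQ mQ; rewrite -excess_slices // -excess1.
apply: (tight_replace tP); rewrite ?sub1set //; first exact: slices_disj.
move=> _ C /imsetP [B BQ ->] /setDP [CP]; rewrite inE => CA.
apply: contraNeq CA => H; apply/eqP.
case/disj_familyP: (tight_disj tP) => _; apply=> //.
by apply: contraNneq H => E; rewrite setIC setIA E set0I.
Qed.

(* Absorbing the members of Q into A one by one; supermodularity applies only to
   sets of positive value, and the tightness of P keeps the union positive. *)
Lemma uncross_sum lam lam' P P' A Q :
  tight lam P -> tight lam' P' -> (lam <= lam')%N -> A \in P ->
  Q \subset meeting P' A ->
  r A + \sum_(B in Q) r B <= \sum_(B in Q) r (A :&: B) + r (A :|: cover Q)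
  /\ 0 < r (A :|: cover Q).
Proof.
move=> tP tP' le AP; move: {2}(#|Q|) (erefl #|Q|) => n.
elim: n Q => [|n IH] Q cQ QP.
  move/eqP: cQ; rewrite cards_eq0 => /eqP ->; rewrite !big_set0 /cover big_set0.
  rewrite setU0 addr0 add0r; split=> //; exact: le_lt_trans (le0z_nat _) (tight_gt tP AP).
have /card_gt0P [B BQ] : (0 < #|Q|)%N by rewrite cQ.
have cQ' : #|Q :\ B| = n by have := cardsD1 B Q; rewrite BQ cQ => -[].
have QP' : Q :\ B \subset meeting P' A by apply: subset_trans QP; apply: subD1set.
have [IH1 IH2] := IH _ cQ' QP'.
have mQ C : C \in Q -> [/\ C \in P', A :&: C != set0 & lam'%:Z < r C].
  move=> /(subsetP QP); rewrite inE => /andP [CP mC]; split=> //.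
  exact: tight_gt CP.
have [BP mB rB] := mQ B BQ.
have dP' := tight_disj tP'; case/disj_familyP: (dP') => nP' iP'.
have dQ : disj_family Q.
  by apply: disj_familyS dP'; apply: subset_trans QP (meeting_sub _ _).
have UI : (A :|: cover (Q :\ B)) :&: B = A :&: B.
  rewrite setIUl; suff -> : cover (Q :\ B) :&: B = set0 by rewrite setU0.
  apply/setP => x; rewrite inE in_set0; apply/negP => /andP [/bigcupP [C]].
  rewrite !inE => /andP [CB CQ] xC xB; move/eqP: CB; apply; apply: iP' => //.
    by case: (mQ C CQ).
  by apply/set0Pn; exists x; rewrite inE xC.
have UU : (A :|: cover (Q :\ B)) :|: B = A :|: cover Q.
  by rewrite -setUA; congr (_ :|: _); rewrite /cover [in RHS](big_setD1 B) //= setUC.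
have := r_super (X := A :|: cover (Q :\ B)) (Y := B).
rewrite UI UU => /(_ mB IH2) H; have {}H := H (le_lt_trans (le0z_nat lam') rB).
have S1 : r A + \sum_(B in Q) r B <= \sum_(B in Q) r (A :&: B) + r (A :|: cover Q).
  have arith (a b t ab t' u u' : int) :
      a + t <= t' + u' -> u' + b <= ab + u -> a + (b + t) <= ab + t' + u by clear; lia.
  by rewrite !(big_setD1 B BQ) /=; exact: arith IH1 H.
split=> //.
(* Positivity of the union: with k the size of [Q], [S1] and [H2] give a value of at least the sum
   of the [r B] minus (k - 1) [lam]. Each [r B] is at least [lam] + 1, so this is at least k +
   [lam]. *)
have H2 := slices_excess_le tP AP dQ (fun C CQ => let: And3 _ h _ := mQ C CQ in h).
have H3 : \sum_(C in Q) (lam%:Z + 1) <= \sum_(C in Q) r C.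
  by apply: ler_sum => C /mQ [_ _]; move: le; clear; lia.
rewrite sumrB !sumz_const cQ in H2 H3.
have arith (a t t' u k l : int) : 0 < k -> 0 <= l -> a + t <= t' + u ->
    t' - k * l <= a - l -> k * (l + 1) <= t -> 0 < u.
  by clear; rewrite mulrDr mulr1; lia.
exact: arith S1 H2 H3.
Qed.

(* The two inequalities coming from the tightness of P and P' add up to the
   reverse of uncross_sum because lam <= lam', so both are equalities. *)
Lemma uncross lam lam' P P' A :
  tight lam P -> tight lam' P' -> (lam <= lam')%N -> A \in P ->
  meeting P' A != set0 ->
  excess lam (slices (meeting P' A) A) = r A - lam%:Z /\
  r (A :|: cover (meeting P' A)) - lam'%:Z = excess lam' (meeting P' A).
Proof.
set Q := meeting P' A => tP tP' le AP nQ.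
have [H1 _] := uncross_sum tP tP' le AP (subxx Q).
have dP' := tight_disj tP'; case/disj_familyP: (dP') => nP' iP'.
have dQ : disj_family Q := disj_familyS (meeting_sub _ _) dP'.
have mQ B : B \in Q -> A :&: B != set0 by rewrite inE => /andP [].
have H2 := slices_excess_le tP AP dQ mQ.
have nU : A :|: cover Q != set0.
  case/disj_familyP: (tight_disj tP) => /(_ A AP) nA _.
  by rewrite setU_eq0 negb_and nA.
have H3 : r (A :|: cover Q) - lam'%:Z <= excess lam' Q.
  rewrite -excess1; apply: (tight_replace tP') => //.
  - exact: meeting_sub.
  - exact: disj_family1.
  move=> _ C /set1P -> /setDP [CP]; rewrite inE CP /= negbK => /eqP AC.
  rewrite setIUl AC set0U; apply/setP => x; rewrite inE in_set0.
  apply/negP => /andP [/bigcupP [B BQ xB] xC]; have := mQ B BQ.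
  rewrite (iP' B C) ?AC ?eqxx //; first by move: BQ; rewrite inE => /andP [].
  by apply/set0Pn; exists x; rewrite inE xB.
have arith (a t t' u k l l' : int) : 0 < k -> l <= l' -> a + t <= t' + u ->
    t' - k * l <= a - l -> u - l' <= t - k * l' ->
    t' - k * l = a - l /\ u - l' = t - k * l'.
  (* Adding the three inequalities leaves the gap (k - 1)(l' - l), which is nonnegative since [Q] is
     nonempty. *)
  clear=> k0 ll; have : 0 <= (k - 1) * (l' - l) by apply: mulr_ge0; lia.
  by rewrite mulrBl !mulrBr; lia.
rewrite excess_slices // excessE sumrB sumz_const.
rewrite excessE in H3; rewrite sumrB sumz_const in H2.
by apply: (arith _ _ _ _ _ _ _ _ _ H1 H2 H3); rewrite // ltz_nat card_gt0.
Qed.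

(** By [uncross], cutting [A] into its slices keeps the excess of [P]. As the weight of [P] is
    minimal, the slices weigh at least as much as [A], so there is only one slice and it is [A]
    itself. *)
Lemma finest_sub lam lam' P P' A :
  tight lam P -> (forall Q, tight lam Q -> (weight P <= weight Q)%N) ->
  tight lam' P' -> (lam <= lam')%N -> A \in P -> meeting P' A != set0 ->
  exists2 B, B \in P' & A \subset B.
Proof.
move=> tP minP tP' le AP nQ; have [H _] := uncross tP tP' le AP nQ.
move: nQ H; set Q := meeting P' A => nQ H.
have dP' := tight_disj tP'.
have dQ : disj_family Q := disj_familyS (meeting_sub _ _) dP'.
have mQ B : B \in Q -> A :&: B != set0 by rewrite inE => /andP [].
have dS := slices_disj dQ mQ.
case/disj_familyP: (tight_disj tP) => nP iP.
have sA : [set A] \subset P by rewrite sub1set.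
have dPS C D : C \in slices Q A -> D \in P :\: [set A] -> C :&: D = set0.
  move=> /imsetP [B BQ ->] /setDP [DP]; rewrite inE => DA.
  apply: contraNeq DA => DB; apply/eqP/iP => //.
  by apply: contraNneq DB => E; rewrite setIC setIA E set0I.
have disj := replace_disjoint dS dPS.
have := excess_replace lam sA disj; rewrite excess1 H (tight_excess tP).
move=> /addIr E.
(* Some slices may have value at most [lam]; filtering them out restores tightness and only lowers
   the weight. *)
have := minP _ (tight_filter (disj_family_replace (tight_disj tP) dS dPS) E).
move=> /leq_trans /(_ (weight_filter _ _)).
have := weight_replace sA disj; rewrite weight1.
have := weightE dS; rewrite card_slices // => E1 E2 E3.
have nA : (0 < #|A|)%N by rewrite card_gt0 nP.
have c1 := subset_leq_card (cover_slices Q A).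
rewrite -card_gt0 in nQ.
have /cards1P [B EB] : #|Q| == 1%N by move: nA c1 nQ E1 E2 E3; clear; lia.
have BQ : B \in Q by rewrite EB inE.
exists B; first by apply: (subsetP (meeting_sub _ _) _ BQ).
have : A :&: B == A.
  rewrite eqEcard subsetIl /=; move: c1 E1 E2 E3.
  by rewrite /slices EB imset_set1 /cover big_set1 cards1; move: nA; clear; lia.
by move/eqP/setIidPl.
Qed.

(** Dual to [finest_sub]: merging [A] with all members of [P'] that it meets keeps the excess of
    [P']. Maximal weight then allows only one such member, and it already contains [A]. *)
Lemma coarsest_sub lam lam' P P' A :
  tight lam P -> tight lam' P' ->
  (forall Q, tight lam' Q -> (weight Q <= weight P')%N) ->
  (lam <= lam')%N -> A \in P -> meeting P' A != set0 ->
  exists2 B, B \in P' & A \subset B.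
Proof.
move=> tP tP' maxP le AP nQ; have [_ H] := uncross tP tP' le AP nQ.
move: nQ H; set Q := meeting P' A => nQ H.
have dP' := tight_disj tP'; case/disj_familyP: (dP') => nP' iP'.
have sQ : Q \subset P' := meeting_sub _ _.
have dQ : disj_family Q := disj_familyS sQ dP'.
have mQ B : B \in Q -> A :&: B != set0 by rewrite inE => /andP [].
have nU : A :|: cover Q != set0.
  case/disj_familyP: (tight_disj tP) => /(_ A AP) nA _.
  by rewrite setU_eq0 negb_and nA.
have dU := disj_family1 nU.
have dPS C D : C \in [set A :|: cover Q] -> D \in P' :\: Q -> C :&: D = set0.
  move=> /set1P -> /setDP [DP]; rewrite inE DP /= negbK => /eqP AD.
  rewrite setIUl AD set0U; apply/setP => x; rewrite inE in_set0.
  apply/negP => /andP [/bigcupP [B BQ xB] xD]; have := mQ B BQ.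
  rewrite (iP' B D) ?AD ?eqxx //; first exact: (subsetP sQ).
  by apply/set0Pn; exists x; rewrite inE xB.
have disj := replace_disjoint dU dPS.
have := excess_replace lam' sQ disj; rewrite excess1 H (tight_excess tP') => /addIr E.
have /set0Pn [B BQ] := nQ.
have BP : B \in P' := subsetP sQ _ BQ.
(* The merged set inherits the whole excess of [Q], a nonempty sum of positive terms. *)
have rU : lam'%:Z < r (A :|: cover Q).
  rewrite -subr_gt0 H /excess (big_setD1 B) //=; apply: ltr_wpDr.
    apply: sumr_ge0 => C /setD1P [_ /(subsetP sQ) /(tight_gt tP') /ltW].
    by rewrite subr_ge0.
  by rewrite subr_gt0; exact: tight_gt BP.
have tN : tight lam' (P' :\: Q :|: [set A :|: cover Q]).
  rewrite /tight disj_family_replace // E eqxx andbT /=.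
  apply/forall_inP => C /setUP [/setDP [CP _]|/set1P -> //].
  exact: tight_gt CP.
have := maxP _ tN; have := weight_replace sQ disj; rewrite weight1.
have := weightE dQ => E1 E2 E3.
have nU' : (0 < #|A :|: cover Q|)%N by rewrite card_gt0.
have c1 := subset_leq_card (subsetUr A (cover Q)).
rewrite -card_gt0 in nQ.
have /cards1P [C EC] : #|Q| == 1%N by move: nU' c1 nQ E1 E2 E3; clear; lia.
move: BQ; rewrite EC => /set1P EB; exists B => //.
have : cover Q == A :|: cover Q.
  by rewrite eqEcard subsetUr /=; move: nU' c1 nQ E1 E2 E3; clear; lia.
rewrite EC /cover big_set1 -EB => /eqP ->; exact: subsetUl.
Qed.

(** Descending induction on the level, starting from [W1] at [lam1]. The current set is always a
    member of some tight family of no lower level, which lets [finest_sub] place a member of the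
    next finest family inside it. *)
Lemma tight_chain_point lam1 P1 W1 :
  tight lam1 P1 -> (forall Q, tight lam1 Q -> (weight Q <= weight P1)%N) ->
  (forall lam P, tight lam P -> (lam <= lam1)%N) -> W1 \in P1 ->
  exists2 I : {set T}, I != set0 /\ I \subset W1 &
    forall lam P, tight lam P -> exists2 B, B \in P & I \subset B.
Proof.
move=> tP1 _ top WP1.
(* After n steps the levels from [lam1] + 1 - n upwards are settled. The successor in the bound on
   the level of [Q] admits the start n = 0, where [W1] sits at level [lam1]; moving to level k needs
   only k <= [lamI]. *)
suff H n : (n <= lam1.+1)%N -> exists I, [/\ I != set0, I \subset W1,
    (exists lam Q, [/\ tight lam Q, I \in Q & (lam1.+1 - n <= lam.+1)%N]) &
    forall lam P, tight lam P -> (lam1.+1 - n <= lam)%N ->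
      exists2 B, B \in P & I \subset B].
  have [I [nI sI _ cI]] := H lam1.+1 (leqnn _); exists I => // lam P tP.
  by apply: (cI lam P tP); lia.
elim: n => [_|n IH len].
  exists W1; split=> //; last by move=> lam P /top; lia.
    by case/disj_familyP: (tight_disj tP1) => /(_ _ WP1).
  by exists lam1, P1; split=> //; lia.
have [I [nI sI [lamI [PI [tPI IPI leI]]] cI]] := IH (ltnW len).
set k := (lam1.+1 - n.+1)%N.
have ek : (lam1.+1 - n = k.+1)%N by lia.
rewrite {}ek ltnS in leI cI.
case: (boolP [exists P, tight k P]) => [/existsP [P0 tP0]|/existsPn nt]; last first.
  exists I; split=> // [|lam P tP]; first by exists lamI, PI; split=> //; lia.
  by rewrite leq_eqVlt => /predU1P [E|]; [move: (nt P); rewrite E tP|exact: cI].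
pose P := [arg min_(P < P0 | tight k P) weight P].
have [tP minP] : tight k P /\ forall Q, tight k Q -> (weight P <= weight Q)%N.
  by rewrite /P; case: arg_minnP.
have rI : k%:Z < r I by have := tight_gt tPI IPI; move: leI; clear; lia.
have [A AP AI] := tight_meets tP nI rI.
have mI : meeting PI A != set0 by apply/set0Pn; exists I; rewrite inE IPI.
have [B BPI AB] := finest_sub tP minP tPI leI AP mI.
have nA : A != set0 by case/disj_familyP: (tight_disj tP) => /(_ _ AP).
(* [B] and [I] are members of the same disjoint family and both meet [A]. *)
have EB : B = I.
  case/disj_familyP: (tight_disj tPI) => _; apply=> //.
  by apply: contraNneq AI => BI; rewrite -subset0 -BI setSI.
rewrite {}EB in AB.
exists A; split=> //; first exact: subset_trans AB sI.
  by exists k, P; split.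
move=> lam Q tQ; rewrite leq_eqVlt => /predU1P [E|/(cI _ _ tQ) [B' BQ IB]]; last first.
  by exists B' => //; apply: subset_trans IB.
(* Another tight family at level k itself: [finest_sub] with equal levels. *)
rewrite -{}E in tQ.
have [C CQ CA] := tight_meets tQ nA (tight_gt tP AP).
apply: (finest_sub tP minP tQ (leqnn _) AP).
by apply/set0Pn; exists C; rewrite inE CQ setIC.
Qed.

(** Take a member [W1] with [u] in the coarsest family at the top level and z in the last set of the
    chain inside [W1]. In any tight family the member containing z meets [W1], hence lies in it by
    [coarsest_sub] and inherits [u]. *)
Lemma common_point (u : pred {set T}) n :
  (forall A B, A \subset B -> u B -> u A) ->
  (forall lam P, tight lam P -> exists2 W, W \in P & u W) ->
  (forall lam P, tight lam P -> (lam <= n)%N) ->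
  (exists lam P, tight lam P) ->
  exists z, forall lam P, disj_family P -> excess lam P = F lam ->
    exists W, [/\ W \in P, u W & z \in W].
Proof.
move=> uS uT leN [lam0 [P0 tP0]].
have ex : exists lam, [exists P, tight lam P] by exists lam0; apply/existsP; exists P0.
have le lam : [exists P, tight lam P] -> (lam <= n)%N by case/existsP => P /leN.
case: (ex_maxnP ex le) => lam1 /existsP [Q0 tQ0] top.
pose P1 := [arg max_(P > Q0 | tight lam1 P) weight P].
have [tP1 maxP] : tight lam1 P1 /\ forall Q, tight lam1 Q -> (weight Q <= weight P1)%N.
  by rewrite /P1; case: arg_maxnP.
have {}top lam P : tight lam P -> (lam <= lam1)%N.
  by move=> tP; apply: top; apply/existsP; exists P.
have [W1 WP1 uW1] := uT _ _ tP1.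
have [I [/set0Pn [z zI] IW] cI] := tight_chain_point tP1 maxP top WP1.
exists z => lam P dP eP; have tP := tight_filter dP eP.
have [A AP IA] := cI _ _ tP.
have zA : z \in A := subsetP IA z zI.
have zW := subsetP IW z zI.
have mA : meeting P1 A != set0.
  apply/set0Pn; exists W1; rewrite inE WP1; apply/set0Pn; exists z.
  by rewrite inE zA.
have [B BP AB] := coarsest_sub tP tP1 maxP (top _ _ tP) AP mA.
have EB : B = W1.
  case/disj_familyP: (tight_disj tP1) => _; apply=> //.
  by apply/set0Pn; exists z; rewrite inE zW (subsetP AB).
exists A; split=> //; first by move: AP; rewrite inE => /andP [].
by apply: uS uW1; rewrite -EB.
Qed.

End Families.

(** * Choosing the neighbourhoods one node at a time *)

Section Transversal.
Variable T : finType.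
Implicit Types (q : {set T} -> int) (W X Y Z : {set T}) (P : {set {set T}}).

Definition hits Z W : bool := Z :&: W != set0.

Definition residual q Z W : int := q W - (hits Z W)%:Z.

Lemma hitsS Z X Y : X \subset Y -> hits Z X -> hits Z Y.
Proof.
move=> XY; apply: contraNneq => E; rewrite -subset0 -E; exact: setIS.
Qed.

Lemma hitsU Z X Y : hits Z (X :|: Y) = hits Z X || hits Z Y.
Proof. by rewrite /hits setIUr setU_eq0 negb_and. Qed.

Lemma hits_setU1 Z z W : hits (z |: Z) W = (z \in W) || hits Z W.
Proof.
rewrite /hits setIUl setU_eq0 negb_and; congr (_ || _).
by rewrite setI_eq0 disjoints1 negbK.
Qed.

(** The indicator of meeting [Z] is submodular, so subtracting it keeps the inequality; sets of
    positive residual value also have positive [q]. *)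
Lemma residual_super q Z :
  pos_intersecting_supermodular q -> pos_intersecting_supermodular (residual q Z).
Proof.
move=> sq X Y XY; rewrite /residual => qX qY.
have pos W : 0 < q W - (hits Z W)%:Z -> 0 < q W by case: hits; clear; lia.
have {sq pos qX qY} := sq X Y XY (pos X qX) (pos Y qY).
have := @hitsS Z _ _ (subsetIl X Y); have := @hitsS Z _ _ (subsetIr X Y).
rewrite hitsU; case: (hits Z X); case: (hits Z Y); case: (hits Z (X :&: Y)) => //=;
  by do ?[move=> /(_ isT)]; clear; lia.
Qed.

Definition bounded_by (q : {set T} -> int) (F : nat -> int) : Prop :=
  forall lam P, disj_family P -> excess q lam P <= F lam.

Lemma excess_residual q Z lam P :
  excess (residual q Z) lam P = excess q lam P - \sum_(W in P) (hits Z W)%:Z.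
Proof. by rewrite /excess /residual -sumrB; apply: eq_bigr => W _; rewrite addrAC. Qed.

(* If Z met every member of a tight P at level lam, then excess q lam.+1 P would
   exceed F lam; so each tight family has an unmet member. *)
Lemma extend_transversal q (F : nat -> int) n rem Z :
  pos_intersecting_supermodular q ->
  (forall lam, 0 <= F lam) ->
  (forall W, W != set0 -> q W <= n%:Z) ->
  (forall lam P, disj_family P -> excess q lam.+1 P <= F lam) ->
  bounded_by (residual q Z) (fun lam => F lam + rem.+1%:Z) ->
  exists2 Z' : {set T}, (#|Z'| <= #|Z|.+1)%N &
    bounded_by (residual q Z') (fun lam => F lam + rem%:Z).
Proof.
move=> sq F0 qn qF bq; pose F' lam := F lam + rem.+1%:Z.
have sr := residual_super (Z := Z) sq.
(* A tight family has a member of value above [lam] and at most [n], so levels up to [n] suffice. If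
   none is tight, integrality already gives slack one and [Z] stays as it is. *)
case: (boolP [exists lam : 'I_n.+1, exists P, tight (residual q Z) F' lam P]); last first.
  move=> /existsPn nt; exists Z; first exact: leqnSn.
  move=> lam P dP; have := bq lam P dP.
  rewrite le_eqVlt => /predU1P [E|]; last by clear; lia.
  have tP := tight_filter bq dP E.
  set Q := [set W in P | _] in tP.
  have /set0Pn [W WQ] : Q != set0.
    apply/eqP => Q0; have := tight_excess tP; rewrite Q0 /excess big_set0 /F'.
    by have := F0 lam; clear; lia.
  have lamn : (lam < n.+1)%N.
    have nW : W != set0 by case/disj_familyP: (tight_disj tP) => /(_ _ WQ).
    by have := tight_gt tP WQ; have := qn W nW; rewrite /residual; clear; lia.
  by have := nt (Ordinal lamn); rewrite negb_exists => /forallP /(_ Q); rewrite tP.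
move=> /existsP [lam0 /existsP [P0 tP0]].
have unhit lam P : tight (residual q Z) F' lam P -> exists2 W, W \in P & ~~ hits Z W.
  move=> tP; apply/exists_inP; rewrite -[X in is_true X]negbK negb_exists_in.
  apply/negP => /forall_inP all_hit.
  have := qF lam P (tight_disj tP); have := tight_excess tP.
  rewrite excess_residual /excess -sumrB /F' => E.
  suff -> : \sum_(W in P) (q W - lam.+1%:Z) = F lam + rem.+1%:Z by clear; lia.
  rewrite -E; apply: eq_bigr => W /all_hit; rewrite negbK => ->; clear; lia.
have [|lam P tP||z zP] := @common_point _ _ F' sr bq (fun W => ~~ hits Z W) n _ unhit.
- by move=> A B AB; apply: contra; apply: hitsS.
- have [W WP _] := unhit _ _ tP.
  have nW : W != set0 by case/disj_familyP: (tight_disj tP) => /(_ _ WP).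
  by have := tight_gt tP WP; have := qn W nW; rewrite /residual; clear; lia.
- by exists lam0, P0.
exists (z |: Z); first by rewrite cardsU1; case: (_ \notin _).
move=> lam P dP; have le := bq lam P dP.
have mono : \sum_(W in P) (hits Z W)%:Z <= \sum_(W in P) (hits (z |: Z) W)%:Z :> int.
  apply: ler_sum => W _; rewrite hits_setU1.
  by case: (hits Z W); rewrite ?orbT //; case: (_ \in _).
(* A family below the bound has slack one already; one attaining it loses one at the member that z
   newly meets. *)
have [E|NE] := eqVneq (excess (residual q Z) lam P) (F' lam); last first.
  move: mono NE le; rewrite !excess_residual /F'; clear; lia.
have [W [WP uW zW]] := zP lam P dP E.
suff : \sum_(W in P) (hits Z W)%:Z < \sum_(W in P) (hits (z |: Z) W)%:Z :> int.
  move: E; rewrite !excess_residual /F'; clear; lia.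
rewrite (big_setD1 W WP) [ltRHS](big_setD1 W WP) /= hits_setU1 zW (negbTE uW) /=.
rewrite ltr_leD //; apply: ler_sum => C _.
by rewrite hits_setU1; case: (hits Z C); rewrite ?orbT //; case: (_ \in _).
Qed.

(** Starting from the empty set with slack [m], each extension costs at most one element and removes
    one unit of slack. *)
Lemma transversal_exists q (F : nat -> int) n m :
  pos_intersecting_supermodular q ->
  (forall lam, 0 <= F lam) ->
  (forall W, W != set0 -> q W <= n%:Z) ->
  (forall lam P, disj_family P -> excess q lam.+1 P <= F lam) ->
  bounded_by q (fun lam => F lam + m%:Z) ->
  exists2 Z : {set T}, (#|Z| <= m)%N & bounded_by (residual q Z) F.
Proof.
move=> sq F0 qn qF bq.
suff H k : (k <= m)%N -> exists2 Z : {set T}, (#|Z| <= k)%N &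
    bounded_by (residual q Z) (fun lam => F lam + (m - k)%N%:Z).
  have [Z cZ bZ] := H m (leqnn _); exists Z => // lam P dP.
  by have := bZ lam P dP; rewrite subnn addr0.
elim: k => [_|k IH lt].
  exists set0; rewrite ?cards0 // => lam P dP; rewrite subn0.
  rewrite excess_residual big1 ?subr0 ?bq // => W _.
  by rewrite /hits set0I eqxx.
have [Z cZ bZ] := IH (ltnW lt).
have [|Z' cZ' bZ'] := @extend_transversal q F n (m - k.+1) Z sq F0 qn qF.
- by move=> lam P dP; rewrite subnSK //; exact: bZ.
by exists Z' => //; exact: leq_trans cZ' _.
Qed.

(** Induction on [s]: the head gets [Z] from [transversal_exists] with [F] computed from the tail,
    and the tail serves the residual demand. For empty [s] the bound at level 0 says that no demand
    is left. *)
Lemma neighbourhoods_exist (I : eqType) (m : I -> nat) (s : seq I) q :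
  uniq s -> sorted (fun a b => (m b <= m a)%N) s ->
  pos_intersecting_supermodular q ->
  (forall lam P, disj_family P ->
     excess q lam P <= (\sum_(i <- drop lam s) m i)%N%:Z) ->
  exists2 N : I -> {set T}, (forall i, i \in s -> #|N i| <= m i)%N &
    forall Y, Y != set0 -> q Y <= (count (fun i => hits (N i) Y) s)%:Z.
Proof.
elim: s q => [|a s IH] q /=.
  move=> _ _ _ b; exists (fun=> set0) => // Y nY.
  by have := b 0%N [set Y] (disj_family1 nY); rewrite excess1 big_nil subr0.
move=> /andP [nas us] pa sq b.
pose F lam : int := (\sum_(i <- drop lam s) m i)%N%:Z.
(* Decreasing order enters here: the element dropped from the tail but not from the whole list has
   value at most [m a]. *)
have drop_le lam :
    (\sum_(i <- drop lam (a :: s)) m i <= m a + \sum_(i <- drop lam s) m i)%N.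
  elim: s lam a pa {IH nas us b F} => [|c s IH] [|lam] a /=; rewrite ?big_cons ?leq_addr //.
    by rewrite big_nil.
  move=> /andP [ca pc]; apply: leq_trans (IH lam c pc) _; exact: leq_add.
have [||||Z cZ bZ] := @transversal_exists q F (size s).+1 (m a) sq.
- by [].
(* At this level the whole list is dropped, so the bound is zero. *)
- move=> W nW; have := b (size s).+1 [set W] (disj_family1 nW).
  by rewrite excess1 /= drop_size big_nil subr_le0.
- by move=> lam P dP; exact: b.
- move=> lam P dP; apply: le_trans (b lam P dP) _; rewrite /F.
  by have := drop_le lam; clear; lia.
have [N cN hN] := IH _ us (path_sorted pa) (residual_super sq) bZ.
exists (fun i => if i == a then Z else N i).
  move=> i; rewrite inE; case: eqP => [-> //|_ /=]; exact: cN.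
move=> Y nY; rewrite eqxx.
have -> : count (fun i => hits (if i == a then Z else N i) Y) s =
          count (fun i => hits (N i) Y) s.
  by apply: eq_in_count => i is_; case: eqP => // E; rewrite -E is_ in nas.
have := hN Y nY; rewrite /residual; clear; lia.
Qed.

End Transversal.

Lemma eq_of_sum_le (I : finType) (f g : I -> nat) :
  (forall i, f i <= g i)%N -> (\sum_i g i <= \sum_i f i)%N -> f =1 g.
Proof.
move=> le; rewrite (geq_leqif (leqif_sum (fun i _ => leqif_eq (le i)))).
by move/forallP => E i; apply/eqP/E.
Qed.

(** * Degree-prescribed graphs and the degree inequality *)

Section DegreePrescribed.
Variables (S T : finType) (mS : S -> nat) (mT : T -> nat) (gamma : nat).
Variable p : {set T} -> int.

Definition nbrs (G : bigraph S T) (s : S) : {set T} := [set t | (s, t) \in G].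

Lemma mem_Gamma (G : bigraph S T) (Y : {set T}) s :
  (s \in Gamma G Y) = hits (nbrs G s) Y.
Proof.
rewrite inE; apply/exists_inP/set0Pn => [[t tY st]|[t]].
  by exists t; rewrite !inE st.
by rewrite !inE => /andP [st tY]; exists t.
Qed.

Lemma card_Gamma (G : bigraph S T) (Y : {set T}) :
  #|Gamma G Y| = (\sum_s hits (nbrs G s) Y)%N.
Proof.
rewrite -sum1_card big_mkcond; apply: eq_bigr => s _.
by rewrite mem_Gamma; case: hits.
Qed.

Lemma degS_nbrs (G : bigraph S T) s : degS G s = #|nbrs G s|.
Proof.
have inj : injective (pair s : T -> S * T) by move=> x y [].
rewrite /degS -(card_imset _ inj); apply: eq_card => -[s' t'].
rewrite !inE /=; apply/andP/imsetP => [[st /eqP E]|[t]].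
  by exists t'; rewrite -?E ?inE.
by rewrite inE => st [-> ->].
Qed.

Lemma degT_Gamma (G : bigraph S T) t : degT G t = #|Gamma G [set t]|.
Proof.
have inj : injective (fun s : S => (s, t)) by move=> x y [].
rewrite /degT -(card_imset _ inj); apply: eq_card => -[s' t'].
rewrite !inE /=; apply/andP/imsetP => [[st /eqP E]|[s]].
  by exists s'; rewrite -?E // inE; apply/exists_inP; exists t'; rewrite ?set11.
by rewrite inE => /exists_inP [x /set1P -> st] [-> ->].
Qed.

Lemma hits1 (Z : {set T}) t : hits Z [set t] = (t \in Z).
Proof. by rewrite /hits setI_eq0 disjoint_sym disjoints1 negbK. Qed.

Lemma sum_hits_le (Z : {set T}) (P : {set {set T}}) :
  trivIset P -> (\sum_(W in P) hits Z W <= #|Z :&: cover P|)%N.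
Proof.
move=> tP; rewrite -[leqRHS]sum1_card.
rewrite (eq_bigl (fun x => (x \in cover P) && (x \in Z))); last first.
  by move=> x; rewrite inE andbC.
rewrite big_trivIset_cond //=; apply: leq_sum => W _.
rewrite (eq_bigl (mem (Z :&: W))); last by move=> x; rewrite !inE andbC.
by rewrite sum1_card /hits -card_gt0; case: #|_|.
Qed.

(** For each node s count its neighbours in [Y] plus the members of [P] it reaches. This is at most
    |Y| + |P|, used for s in [X], and at most [mS s], used outside [X]. *)
Lemma degree_ineq_necessary (X : {set S}) (Y : {set T}) (P : {set {set T}}) :
  tilde mS [set: S] = gamma -> subpartition (~: Y) P ->
  (exists G : bigraph S T, covers G p /\ fits G mS mT) ->
  degree_ineq mS mT gamma p X Y P.
Proof.
move=> hS [_ tP cP] [G [cG [fS fT]]].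
have pP : ptilde p P <= (\sum_s \sum_(W in P) hits (nbrs G s) W)%N%:Z.
  rewrite exchange_big /= -[_%:Z]natz natr_sum; apply: ler_sum => W _.
  by rewrite natz -card_Gamma.
have mY : tilde mT Y = (\sum_s #|nbrs G s :&: Y|)%N.
  transitivity (\sum_(t in Y) \sum_s (t \in nbrs G s))%N.
    apply: eq_bigr => t _; rewrite -fT degT_Gamma card_Gamma.
    by apply: eq_bigr => s _; rewrite hits1.
  rewrite exchange_big /=; apply: eq_bigr => s _.
  rewrite -sum1_card [RHS]big_mkcond [LHS]big_mkcond; apply: eq_bigr => t _.
  by rewrite in_setI andbC; case: (t \in Y); case: (t \in nbrs G s).
have bS s : (#|nbrs G s :&: Y| + \sum_(W in P) hits (nbrs G s) W <= mS s)%N.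
  rewrite -fS degS_nbrs -[leqRHS](cardsID Y) leq_add2l.
  apply: leq_trans (sum_hits_le _ tP) _; rewrite setDE.
  exact/subset_leq_card/setIS.
have bX s : (#|nbrs G s :&: Y| + \sum_(W in P) hits (nbrs G s) W <= #|Y| + #|P|)%N.
  apply: leq_add; first exact/subset_leq_card/subsetIr.
  by rewrite -sum1_card; apply: leq_sum => W _; case: hits.
have : (tilde mS X + (tilde mT Y + \sum_s \sum_(W in P) hits (nbrs G s) W)
        <= gamma + #|X| * (#|Y| + #|P|))%N.
  rewrite mY -big_split /= -hS /tilde [in leqRHS](big_setID X) /= setTI.
  rewrite [in X in (_ + X <= _)%N](bigID (mem X)) /=.
  have B1 : (\sum_(s in X) (#|nbrs G s :&: Y| + \sum_(W in P) hits (nbrs G s) W)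
            <= #|X| * (#|Y| + #|P|))%N.
    by rewrite -sum_nat_const; apply: leq_sum.
  have B2 : (\sum_(s | s \notin X) (#|nbrs G s :&: Y| + \sum_(W in P) hits (nbrs G s) W)
            <= \sum_(s in [set: S] :\: X) mS s)%N.
    rewrite [leqRHS](eq_bigl (fun s => s \notin X)); last by move=> s; rewrite !inE andbT.
    exact: leq_sum.
  by rewrite -addnA leq_add2l [leqRHS]addnC; exact: leq_add B1 B2.
by rewrite /degree_ineq mulnDr; move: pP; clear; lia.
Qed.

Hypotheses (hS : tilde mS [set: S] = gamma) (hT : tilde mT [set: T] = gamma).

Hypothesis ineq : forall (X : {set S}) (Y : {set T}) (P : {set {set T}}),
  subpartition (~: Y) P -> degree_ineq mS mT gamma p X Y P.

Definition with_degrees (W : {set T}) : int :=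
  if #|W| == 1%N then (tilde mT W)%:Z else p W.

(** The inequality for empty X, the complement of [W] as Y, and the family {W}. *)
Lemma p_le_degrees W : W != set0 -> p W <= (tilde mT W)%:Z.
Proof.
move=> nW; have sP : subpartition (~: ~: W) [set W].
  rewrite setCK; split; first by rewrite inE eq_sym.
    by case/andP: (disj_family1 nW).
  by rewrite /cover big_set1.
have := ineq set0 sP; rewrite /degree_ineq /ptilde big_set1 !cards0.
rewrite {1}/tilde big_set0 -hT.
have -> : tilde mT [set: T] = (tilde mT W + tilde mT (~: W))%N.
  by rewrite /tilde (big_setID W) /= setTI setTD.
by rewrite /tilde; clear; lia.
Qed.

Lemma p_le_with_degrees W : W != set0 -> p W <= with_degrees W.
Proof. by rewrite /with_degrees; case: ifP => // _; exact: p_le_degrees. Qed.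

(** If one of two intersecting sets is a singleton, it lies in the other and equality holds.
    Otherwise the values on the left are those of [p], and those on the right are at least those of
    [p]. *)
Lemma with_degrees_super :
  pos_intersecting_supermodular p -> pos_intersecting_supermodular with_degrees.
Proof.
move=> sp X Y XY.
have [/cards1P [x EX]|X1] := boolP (#|X| == 1%N).
  suff XsY : X \subset Y by rewrite (setIidPl XsY) (setUidPr XsY).
  by rewrite EX sub1set; move: XY; rewrite setIC EX -/(hits Y [set x]) hits1.
have [/cards1P [y EY]|Y1] := boolP (#|Y| == 1%N).
  suff YsX : Y \subset X by rewrite (setIidPr YsX) (setUidPl YsX) addrC.
  by rewrite EY sub1set; move: XY; rewrite EY -/(hits X [set y]) hits1.
rewrite {1 2 3 4}/with_degrees (negbTE X1) (negbTE Y1) => pX pY.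
apply: le_trans (sp X Y XY pX pY) _; apply: lerD; first exact: p_le_with_degrees.
apply: p_le_with_degrees; apply: contraNneq XY => E.
by rewrite -subset0 -E; apply: subset_trans (subsetIl _ _) (subsetUl _ _).
Qed.

(** The singleton members of [P] form the set [Y] of the degree inequality and the others its
    subpartition, so [lam] |P| splits into |X||Y| and the subpartition term. *)
Lemma excess_with_degrees lam P (X : {set S}) :
  disj_family P -> #|X| = lam ->
  excess with_degrees lam P + (tilde mS X)%:Z <= gamma%:Z.
Proof.
move=> dP cX; pose P1 := [set W in P | #|W| == 1%N].
have P1P : P1 \subset P by apply/subsetP => W; rewrite inE => /andP [].
pose Y := cover P1.
have d1 := disj_familyS P1P dP.
have c1 : #|P1| = #|Y|.
  case/andP: (d1) => /eqP <- _; rewrite -sum1_card; apply: eq_bigr => W.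
  by rewrite inE => /andP [_ /eqP].
have e1 : \sum_(W in P1) with_degrees W = (tilde mT Y)%:Z.
  case/andP: (d1) => t1 _; rewrite /tilde big_trivIset //=.
  rewrite -[RHS]natz natr_sum; apply: eq_bigr => W; rewrite inE => /andP [_ cW].
  by rewrite /with_degrees cW natz.
have e2 : \sum_(W in P :\: P1) with_degrees W = ptilde p (P :\: P1).
  apply: eq_bigr => W /setDP [WP]; rewrite inE WP /= => cW.
  by rewrite /with_degrees (negbTE cW).
have sP : subpartition (~: Y) (P :\: P1).
  case/andP: (disj_familyS (subsetDl P P1) dP) => tD nD; split=> //.
  apply/bigcupsP => W /setDP [WP WP1]; apply/subsetP => t tW; rewrite inE.
  apply/negP => /bigcupP [V VP1 tV]; case/disj_familyP: dP => _ /(_ W V WP).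
  move=> E; move: WP1; rewrite E ?VP1 ?(subsetP P1P) //.
  by apply/set0Pn; exists t; rewrite inE tW.
have arith (x y t g l c k : int) :
    x + y - l * c + t - k * l <= g -> y + t - (c + k) * l + x <= g.
  by rewrite mulrDl; clear; lia.
rewrite excessE (big_setID P1) /= (setIidPr P1P) e1 e2.
rewrite -(cardsID P1 P) (setIidPr P1P) c1 PoszD.
by apply: arith; rewrite -cX; have := ineq X sP; rewrite /degree_ineq.
Qed.

Lemma degree_ineq_sufficient :
  pos_intersecting_supermodular p -> p set0 = 0 ->
  exists G : bigraph S T, covers G p /\ fits G mS mT.
Proof.
move=> sp p0; pose leS := relpre mS geq.
pose s := sort leS (enum S).
have leS_total : total leS by move=> x y; exact: leq_total.
have us : uniq s by rewrite sort_uniq enum_uniq.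
have ms x : x \in s by rewrite mem_sort mem_enum.
have sums (f : S -> nat) : (\sum_(i <- s) f i = \sum_i f i)%N.
  by rewrite (perm_big _ (permEl (perm_sort _ _))) big_enum.
have size_s : size s = #|S| by rewrite size_sort cardE.
have bound lam P : disj_family P ->
    excess with_degrees lam P <= (\sum_(i <- drop lam s) mS i)%N%:Z.
  (* Here X consists of the first k nodes of [s], those of largest [mS]. *)
  have small k : (k <= #|S|)%N -> disj_family P ->
      excess with_degrees k P <= (\sum_(i <- drop k s) mS i)%N%:Z.
    move=> kS dP; have cX : #|[set x in take k s]| = k.
      by rewrite cardsE (card_uniqP (take_uniq _ us)) size_takel // size_s.
    have := excess_with_degrees dP cX.
    suff : (tilde mS [set x in take k s] + \sum_(i <- drop k s) mS i = gamma)%N.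
      by clear; lia.
    rewrite -hS /tilde; under [RHS]eq_bigl do rewrite inE.
    rewrite -sums -[in RHS](cat_take_drop k s) big_cat /=; congr addn.
    by rewrite (big_uniq _ (take_uniq k us)); apply: eq_bigl => x; rewrite inE.
  have [le|lt] := leqP lam #|S|; first exact: small.
  move=> dP; have := small _ (leqnn _) dP.
  (* Beyond level |S| the right side stays zero while the excess can only fall. *)
  rewrite !drop_oversize ?size_s ?(ltnW lt) // !big_nil; apply: le_trans.
  by apply: ler_sum => W _; move: lt; clear; lia.
have [N cN hN] := neighbourhoods_exist us (sort_sorted leS_total _)
  (with_degrees_super sp) bound.
pose G : bigraph S T := [set e | e.2 \in N e.1].
have nG x : nbrs G x = N x by apply/setP => t; rewrite !inE.
have cG Y : Y != set0 -> with_degrees Y <= #|Gamma G Y|%:Z.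
  move=> nY; apply: le_trans (hN Y nY) _; rewrite card_Gamma -sum1_count.
  by rewrite big_mkcond sums; under eq_bigr do rewrite -nG.
have leS' x : (degS G x <= mS x)%N by rewrite degS_nbrs nG cN.
have leT t : (mT t <= degT G t)%N.
  have n1 : [set t] != set0 by rewrite -card_gt0 cards1.
  by have := cG _ n1; rewrite /with_degrees cards1 eqxx /tilde big_set1 degT_Gamma.
(* Degrees are at most [mS] on one side and at least [mT] on the other; since both degree sums count
   the edges and both prescriptions total [gamma], equality holds everywhere. *)
have edges : (\sum_x degS G x = \sum_t degT G t)%N.
  have dS x : degS G x = (\sum_t (t \in nbrs G x))%N.
    by rewrite degS_nbrs -sum1_card big_mkcond; apply: eq_bigr => t _; case: (_ \in _).
  rewrite (eq_bigr _ (fun x _ => dS x)) exchange_big; apply: eq_bigr => t _.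
  by rewrite degT_Gamma card_Gamma; apply: eq_bigr => x _; rewrite hits1.
have sumS : (\sum_x mS x = gamma)%N by rewrite -hS; apply: eq_bigl => x; rewrite inE.
have sumT : (\sum_t mT t = gamma)%N by rewrite -hT; apply: eq_bigl => x; rewrite inE.
exists G; split=> [Y|].
  have [->|nY] := eqVneq Y set0; first by rewrite p0.
  exact: le_trans (p_le_with_degrees nY) (cG Y nY).
have leSumS : (\sum_x degS G x <= \sum_x mS x)%N by apply: leq_sum.
have leSumT : (\sum_t mT t <= \sum_t degT G t)%N by apply: leq_sum.
split=> [x|t].
  by apply: eq_of_sum_le x => //; rewrite edges sumS -sumT.
by apply/esym; apply: eq_of_sum_le t => //; rewrite -edges sumT -sumS.
Qed.

End DegreePrescribed.

(** * Fully supermodular demands and the three characterizations *)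

Lemma supermodular_cover (T : finType) (p : {set T} -> int) (P : {set {set T}}) :
  fully_supermodular p -> p set0 = 0 -> trivIset P -> ptilde p P <= p (cover P).
Proof.
move=> sp p0; move: {2}#|P| (erefl #|P|) => n.
elim: n P => [|n IH] P cP tP.
  move/eqP: cP; rewrite cards_eq0 => /eqP ->.
  by rewrite /ptilde /cover !big_set0 p0.
have /card_gt0P [B BP] : (0 < #|P|)%N by rewrite cP.
have cP' : #|P :\ B| = n by have := cardsD1 B P; rewrite BP cP => -[].
have tP' : trivIset (P :\ B) := trivIsetS (subD1set _ _) tP.
(* Merge [B] with the union of the rest: they are disjoint, so the intersection term is [p set0],
   which is zero. *)
rewrite /ptilde (big_setD1 B) //=; apply: le_trans (lerD (lexx _) (IH _ cP' tP')) _.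
apply: le_trans (sp _ _) _.
have -> : B :|: cover (P :\ B) = cover P by rewrite /cover [RHS](big_setD1 B).
suff -> : B :&: cover (P :\ B) = set0 by rewrite p0 add0r.
apply/eqP; rewrite setI_eq0; apply: bigcup_disjoint => C /setD1P [CB CP].
by move/trivIsetP: tP; apply; rewrite // eq_sym.
Qed.

Theorem theorem14 (S T : finType) (mS : S -> nat) (mT : T -> nat) (gamma : nat)
    (pT : {set T} -> int)
    (hS : tilde mS [set: S] = gamma) (hT : tilde mT [set: T] = gamma)
    (hp : pos_intersecting_supermodular pT)
    (hp0 : pT set0 = 0)
    (hpS : forall Y : {set T}, pT Y <= #|S|%:Z) :
  [/\ (exists G : bigraph S T, covers G pT /\ fits G mS mT) <->
      (forall (X : {set S}) (Y : {set T}) (P : {set {set T}}),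
          subpartition (~: Y) P -> degree_ineq mS mT gamma pT X Y P),
      fully_supermodular pT ->
      ((exists G : bigraph S T, covers G pT /\ fits G mS mT) <->
       (forall (X : {set S}) (Y : {set T}) (P : {set {set T}}),
          subpartition (~: Y) P -> (#|P| <= 1)%N ->
          degree_ineq mS mT gamma pT X Y P))
    & fully_supermodular pT -> monotone_nondecreasing pT ->
      ((exists G : bigraph S T, covers G pT /\ fits G mS mT) <->
       (forall (X : {set S}) (Y : {set T}) (P : {set {set T}}),
          subpartition (~: Y) P -> P = set0 \/ P = [set ~: Y] ->
          degree_ineq mS mT gamma pT X Y P))].
Proof.
have necessary G X Y P : covers G pT /\ fits G mS mT -> subpartition (~: Y) P ->
    degree_ineq mS mT gamma pT X Y P.
  by move=> HG sP; apply: degree_ineq_necessary => //; exists G.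
have sufficient ineq := degree_ineq_sufficient hS hT ineq hp hp0.
have cover_neq0 (Y : {set T}) P : subpartition (~: Y) P -> P != set0 -> cover P != set0.
  move=> [nP _ _] /set0Pn [W WP]; apply: contraNneq nP => E.
  suff <- : W = set0 by [].
  by apply/eqP; rewrite -subset0 -E; exact: bigcup_sup.
have sub1 (Y W : {set T}) : W != set0 -> W \subset ~: Y -> subpartition (~: Y) [set W].
  move=> nW sW; case/andP: (disj_family1 nW) => t n; split=> //.
  by rewrite /cover big_set1.
(* Replacing a nonempty [P] by its union does not lower the demand and does not raise the subtracted
   |P||X|. *)
have reduce (sp : fully_supermodular pT) X Y P : subpartition (~: Y) P -> P != set0 ->
    degree_ineq mS mT gamma pT X Y [set cover P] -> degree_ineq mS mT gamma pT X Y P.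
  move=> [_ tP _] nP; rewrite /degree_ineq {1}/ptilde big_set1 cards1 mul1r.
  apply: le_trans; apply: lerB; first by rewrite lerD2l; exact: supermodular_cover.
  by rewrite ler_peMl // lez_nat card_gt0.
split.
- split=> [[G HG] X Y P|ineq]; [exact: necessary HG|exact: sufficient].
- move=> sp; split=> [[G HG] X Y P sP _|ineq]; first exact: necessary HG sP.
  apply: sufficient => X Y P sP; have [E|nP] := eqVneq P set0.
    by apply: ineq; rewrite ?E ?cards0 // -E.
  apply: reduce => //; apply: ineq; rewrite ?cards1 //.
  by apply: sub1; [exact: cover_neq0 sP nP|case: sP].
- move=> sp mono; split=> [[G HG] X Y P sP _|ineq]; first exact: necessary HG sP.
  apply: sufficient => X Y P sP; have [E|nP] := eqVneq P set0.
    by apply: ineq; [|left].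
  apply: reduce => //; have nC := cover_neq0 Y P sP nP; have [_ _ cP] := sP.
  have nY : ~: Y != set0 by apply: contraNneq nC => E; rewrite -subset0 -E.
  (* Monotonicity replaces the nonempty union by the whole complement of [Y]. *)
  have := ineq X Y [set ~: Y] (sub1 _ _ nY (subxx _)) (or_intror erefl).
  rewrite /degree_ineq /ptilde !big_set1 !cards1; apply: le_trans.
  by rewrite lerD2r lerD2l; exact: mono.
Qed.
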